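(* Let $k>3$ and $n>4k$. If $H$ is a connected $n$-vertex $3$-graph with $\delta_1(H)>\binom{k}{2}$, then $\ell(H)\ge 2k+1$.
   Context: A $3$-graph is a simple $3$-uniform hypergraph; $\delta_1(H)$ is its minimum vertex degree. A Berge path of length $t$ consists of $t+1$ distinct vertices $v_0,\dots,v_t$ and $t$ distinct edges $e_1,\dots,e_t$ with $\{v_{i-1},v_i\}\subseteq e_i$. $H$ is connected if every two vertices are joined by a Berge path; $\ell(H)$ is the length of a longest Berge path in $H$. *)

(* Defs.v *)
From mathcomp Require Import all_boot.

Set Implicit Arguments.
Unset Strict Implicit.
Unset Printing Implicit Defensive.

(* A hypergraph on the vertex type T is its edge set; it is simple because the
   edges form a set of sets. *)
Definition is_3graph (T : finType) (H : {set {set T}}) : Prop :=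
  forall e : {set T}, e \in H -> #|e| = 3.

Definition vertex_degree (T : finType) (H : {set {set T}}) (x : T) : nat :=
  #|[set e in H | x \in e]|.

(* No degree exceeds #|H|, so the default value #|H| of the iterated minimum
   is neutral. *)
Definition min_vertex_degree (T : finType) (H : {set {set T}}) : nat :=
  \big[minn/#|H|]_(x : T) vertex_degree H x.

(* Vertices v_0, ..., v_t and edges e_1, ..., e_t; e_(i+1) is stored as e i, and
   v (widen_ord _ i), v (lift ord0 i) are v_i and v_(i+1). *)
Definition berge_path (T : finType) (H : {set {set T}}) (t : nat)
    (v : {ffun 'I_t.+1 -> T}) (e : {ffun 'I_t -> {set T}}) : bool :=
  [&& injectiveb v, injectiveb e &
      [forall i : 'I_t,
        (e i \in H) &&
        ([set v (widen_ord (leqnSn t) i); v (lift ord0 i)] \subset e i)]].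

Definition berge_connected (T : finType) (H : {set {set T}}) : Prop :=
  forall x y : T,
    exists (t : nat) (v : {ffun 'I_t.+1 -> T}) (e : {ffun 'I_t -> {set T}}),
      [/\ berge_path H v e, v ord0 = x & v ord_max = y].

(* The edges of a Berge path are distinct, so its length is at most #|H|. *)
Definition longest_berge_path (T : finType) (H : {set {set T}}) : nat :=
  \max_(t < #|H|.+1 |
        [exists v : {ffun 'I_t.+1 -> T},
          exists e : {ffun 'I_t -> {set T}}, berge_path H v e]) t.

(* Main.v *)
Require Import Defs.
From mathcomp Require Import all_boot.
From mathcomp Require Import zify.

(** Let [t] be the maximal length of a Berge path and suppose [t <= 2 * k].

    By connectivity a Berge cycle of length [t.+1] would extend to a longer path.
    Given a cycle of length [t], some vertex [w] off it has all its edges inside the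
    cycle plus [w]. If [m] of these edges join [w] to two consecutive vertices and
    the others touch [a] cycle vertices, then, as [w] cannot be inserted into the
    cycle, [2 * a + m <= t], and the degree of [w] is at most [C(a, 2) + m]. This
    contradicts the degree condition unless [k = 4] and [w] is the hub of a wheel;
    exchanging the hub with a rim vertex rules that out too.

    On a longest path the crossing argument then makes the slots reachable from the
    two ends disjoint; the degree condition gives at least [k] to each end, so
    [t = 2 * k]. Since cycles of length [t] are excluded as well, those of the first
    end are the first [k] slots. Hence all edges at [v 0] but the first path edge
    [e 0] lie in [v 0 .. v k]. Replacing [e 0] by another edge through [v 0] and
    [v 1] shows the same for [e 0], and the degree of [v 0] is at most [C(k, 2)]. *)

Set Implicit Arguments.
Unset Strict Implicit.
Unset Printing Implicit Defensive.

(* Membership hypotheses slow [lia] down considerably. *)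
Ltac nlia :=
  repeat match goal with
    | h : is_true (_ \in _) |- _ => clear h
    | h : is_true (~~ (_ \in _)) |- _ => clear h
    end; lia.

(** * Surgery on Berge paths and cycles with vertices and edges indexed by natural numbers *)

Section Constructions.

Variables (T : finType) (H : {set {set T}}).
Implicit Types (v c : nat -> T) (e : nat -> {set T}).

(* The edge [e i] joins [v i] to [v i.+1]; values of [v] beyond [t] and of [e]
   beyond [t.-1] are irrelevant. *)
Definition bpath t v e : Prop :=
  [/\ forall i j, i <= t -> j <= t -> v i = v j -> i = j,
      forall i j, i < t -> j < t -> e i = e j -> i = j
    & forall i, i < t -> [/\ e i \in H, v i \in e i & v i.+1 \in e i]].

(** The cyclic successor modulo [L], by cases so that linear arithmetic can decide goals about
    it. *)
Definition nx L i := if i.+1 < L then i.+1 else 0.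

Definition bcycle L c e : Prop :=
  [/\ forall i j, i < L -> j < L -> c i = c j -> i = j,
      forall i j, i < L -> j < L -> e i = e j -> i = j
    & forall i, i < L -> [/\ e i \in H, c i \in e i & c (nx L i) \in e i]].

Lemma ltn_nx L i : i < L -> nx L i < L.
Proof. by rewrite /nx; case: ifP; nlia. Qed.

Lemma nx_inj L i j : i < L -> j < L -> nx L i = nx L j -> i = j.
Proof. by rewrite /nx; do 2 case: ifP; nlia. Qed.

Lemma bpath_cons t v e w h :
  bpath t v e -> (forall i, i <= t -> v i <> w) -> h \in H -> w \in h ->
  v 0 \in h -> (forall i, i < t -> e i <> h) ->
  bpath t.+1 (fun i => if i is j.+1 then v j else w)
             (fun i => if i is j.+1 then e j else h).
Proof.
move=> [vI eI ve] vw hH wh vh eh; split.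
- move=> [|i] [|j] //= it jt E; first by case: (vw j); rewrite // -E.
    by case: (vw i).
  by congr _.+1; apply: vI.
- move=> [|i] [|j] //= it jt E; first by case: (eh j); rewrite // -E.
    by case: (eh i).
  by congr _.+1; apply: eI.
- by move=> [|i] // it; apply: ve.
Qed.

Lemma bpath_rev t v e :
  bpath t v e -> bpath t (fun i => v (t - i)) (fun i => e (t - i.+1)).
Proof.
move=> [vI eI ve]; split.
- by move=> i j it jt /vI; nlia.
- by move=> i j it jt /eI; nlia.
- move=> i it; have [|? ? ?] := ve (t - i.+1); first nlia.
  by have <- : (t - i.+1).+1 = t - i by nlia.
Qed.

Lemma bpath_set_first t v e f :
  bpath t v e -> 0 < t -> f \in H -> v 0 \in f -> v 1 \in f ->
  (forall i, i < t -> e i <> f) ->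
  bpath t v (fun i => if i is 0 then f else e i).
Proof.
move=> [vI eI ve] t0 fH f0 f1 ef; split=> //.
- move=> [|i] [|j] it jt //; [by move/esym/ef; case | by move/ef; case|].
  by move/eI; apply.
- by move=> [|i] it //; apply: ve.
Qed.

Lemma bpath_close t v e f :
  bpath t v e -> f \in H -> v 0 \in f -> v t \in f ->
  (forall i, i < t -> e i <> f) ->
  bcycle t.+1 v (fun i => if i < t then e i else f).
Proof.
move=> [vI eI ve] fH f0 ft ef; split.
- by move=> i j it jt; apply: vI.
- move=> i j it jt; case: (ltnP i t) => i't; case: (ltnP j t) => j't.
  + exact: eI.
  + by move/ef; case.
  + by move/esym/ef; case.
  + nlia.
- move=> i it; rewrite /nx ltnS; case: (ltnP i t) => i't; first exact: ve.
  by have -> : i = t by nlia.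
Qed.

(** The last edge returns to [v 0] instead of going on to [v t], which is dropped. *)
Lemma bpath_close_last t v e :
  bpath t v e -> 0 < t -> v 0 \in e t.-1 -> bcycle t v e.
Proof.
move=> [vI eI ve] t0 v0; split=> //.
- by move=> i j it jt; apply: vI; nlia.
- move=> i it; have [? ? ?] := ve i it; split=> //; rewrite /nx.
  by case: ifP => // it'; have -> : i = t.-1 by nlia.
Qed.

(** The cycle runs up from [v 0] to [v j], jumps along [g] to [v t], runs down to [v i] and returns
    along [f]. The path edges from [e j] to [e i.-1] are left out, so [f] and [g] may be among
    them. *)
Lemma bpath_cross t v e i j f g :
  bpath t v e -> j < i -> i <= t ->
  f \in H -> v 0 \in f -> v i \in f -> g \in H -> v t \in g -> v j \in g ->
  f <> g ->
  (forall a, a < t -> e a = f -> j <= a < i) ->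
  (forall a, a < t -> e a = g -> j <= a < i) ->
  bcycle (t + j + 2 - i)
    (fun x => if x <= j then v x else v (t + j + 1 - x))
    (fun x => if x < j then e x else if x == j then g else
              if x == t + j + 1 - i then f else e (t + j - x)).
Proof.
move=> [vI eI ve] ji it fH f0 fi gH gt gj fg ef eg.
set L := t + j + 2 - i.
split.
- move=> x y xL yL.
  by case: (leqP x j) => ?; case: (leqP y j) => ? /vI; nlia.
- move=> x y xL yL.
  have eF a : a < t -> (a < j) || (i <= a) -> e a <> f.
    by move=> at_ ai /ef; nlia.
  have eG a : a < t -> (a < j) || (i <= a) -> e a <> g.
    by move=> at_ ai /eg; nlia.
  case: (ltnP x j) => xj; case: (ltnP y j) => yj.
  + by move/eI; nlia.
  + case: eqP => [_|nj]; first by move=> E; case: (eG x) => //; nlia.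
    case: eqP => [_|nL]; first by move=> E; case: (eF x) => //; nlia.
    by move/eI; nlia.
  + case: eqP => [_|nj]; first by move=> E; case: (eG y) => //; nlia.
    case: eqP => [_|nL]; first by move=> E; case: (eF y) => //; nlia.
    by move/eI; nlia.
  + case: (x =P j) => [->|nj]; case: (y =P j) => [->|nj'] //.
    * case: (y =P _) => [_|nL] E; first by case: fg.
      by case: (eG (t + j - y)) => //; nlia.
    * case: (x =P _) => [_|nL] E; first by case: fg.
      by case: (eG (t + j - x)) => //; nlia.
    * case: (x =P _) => nx'; case: (y =P _) => ny' E.
      - by nlia.
      - by case: (eF (t + j - y)) => //; nlia.
      - by case: (eF (t + j - x)) => //; nlia.
      - by move/eI: E; nlia.
- move=> x xL; rewrite /nx.
  case: (ltnP x j) => xj.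
    have [|? ? ?] := ve x; first nlia.
    split=> //; first by rewrite ltnW.
    have xL' : x.+1 < L by nlia.
    by rewrite xL' xj.
  case: eqP => [->|nj].
    rewrite leqnn; split=> //.
    have jL : j.+1 < L by nlia.
    by rewrite jL ltnn; have -> : t + j + 1 - j.+1 = t by nlia.
  have -> : (x <= j) = false by nlia.
  case: eqP => [->|nL].
    split=> //; first by have -> : t + j + 1 - (t + j + 1 - i) = i by nlia.
    by have -> : ((t + j + 1 - i).+1 < L) = false by nlia.
  have [|? ? h] := ve (t + j - x); first nlia.
  split=> //; first by have -> : t + j + 1 - x = (t + j - x).+1 by nlia.
  have -> : x.+1 < L by nlia.
  have -> : (x.+1 <= j) = false by nlia.
  by have -> : t + j + 1 - x.+1 = t + j - x by nlia.
Qed.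

(** The edge [e a] gives way to [f] and [g], so either of them may be [e a] itself. *)
Lemma bcycle_insert L c e w a f g :
  bcycle L c e -> a < L -> (forall i, i < L -> c i <> w) ->
  f \in H -> c a \in f -> w \in f -> g \in H -> w \in g -> c (nx L a) \in g ->
  f <> g ->
  (forall i, i < L -> e i = f -> i = a) ->
  (forall i, i < L -> e i = g -> i = a) ->
  bcycle L.+1
    (fun x => if x <= a then c x else if x == a.+1 then w else c x.-1)
    (fun x => if x < a then e x else if x == a then f else
              if x == a.+1 then g else e x.-1).
Proof.
move=> [cI eI ce] aL cw fH fa fw gH gw ga fg ef eg; split.
- move=> x y xL yL.
  case: (leqP x a) => xa; case: (leqP y a) => ya.
  + by move/cI; nlia.
  + case: eqP => [_|ny]; first by move/cw => h; case: h; nlia.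
    by move/cI; nlia.
  + case: eqP => [_|ny]; first by move/esym/cw => h; case: h; nlia.
    by move/cI; nlia.
  + case: (x =P _) => [->|nx']; case: (y =P _) => [->|ny'] //.
    * by move/esym/cw => h; case: h; nlia.
    * by move/cw => h; case: h; nlia.
    * by move/cI; nlia.
- move=> x y xL yL.
  case: (ltnP x a) => xa; case: (ltnP y a) => ya.
  + by move/eI; nlia.
  + case: eqP => [_|ny]; first by move/ef; nlia.
    case: eqP => [_|ny']; first by move/eg; nlia.
    by move/eI; nlia.
  + case: eqP => [_|ny]; first by move/esym/ef; nlia.
    case: eqP => [_|ny']; first by move/esym/eg; nlia.
    by move/eI; nlia.
  + case: (x =P a) => [->|nj]; case: (y =P a) => [->|nj'] //.
    * by case: (y =P _) => [//|ny /esym/ef]; nlia.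
    * by case: (x =P _) => [_ /esym //|ny /ef]; nlia.
    * case: (x =P _) => [->|nx']; case: (y =P _) => [->|ny'] //.
      - by move/esym/eg; nlia.
      - by move/eg; nlia.
      - by move/eI; nlia.
- move=> x xL.
  case: (ltnP x a) => xa.
    have [|? ?] := ce x; first nlia.
    rewrite /nx; have -> : x.+1 < L by nlia.
    have -> : x.+1 < L.+1 by nlia.
    have xa' : x <= a by nlia.
    by rewrite xa xa'.
  case: (eqVneq x a) => [->|nxa].
    rewrite leqnn; split=> //.
    have -> : nx L.+1 a = a.+1 by rewrite /nx ltnS aL.
    by rewrite ltnn eqxx.
  have -> : (x <= a) = false by nlia.
  case: (eqVneq x a.+1) => [->|nxa'].
    split=> //; move: ga; rewrite /nx ltnS; case: (ltnP a.+1 L) => aL' //.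
    by rewrite ltnNge leqnSn /=; have -> : (a.+2 == a.+1) = false by nlia.
  have [|? ?] := ce x.-1; first nlia.
  rewrite /nx; case: (ltnP x.-1.+1 L) => xL'.
    have -> : x.+1 < L.+1 by nlia.
    have -> : (x.+1 <= a) = false by nlia.
    have -> : (x.+1 == a.+1) = false by nlia.
    by have -> : x.-1.+1 = x.+1.-1 by nlia.
  by have -> : (x.+1 < L.+1) = false by nlia.
Qed.

Definition rotn L r i := if i + r < L then i + r else i + r - L.

Lemma bcycle_rot L c e r :
  bcycle L c e -> r < L ->
  bcycle L (fun i => c (rotn L r i)) (fun i => e (rotn L r i)).
Proof.
move=> [cI eI ce] rL; split.
- by move=> i j iL jL; rewrite /rotn; case: ifP; case: ifP => ? ? /cI; nlia.
- by move=> i j iL jL; rewrite /rotn; case: ifP; case: ifP => ? ? /eI; nlia.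
- move=> i iL; have [|? ? h] := ce (rotn L r i).
    by rewrite /rotn; case: ifP; nlia.
  split=> //; move: h; have -> // : nx L (rotn L r i) = rotn L r (nx L i).
  by rewrite /nx /rotn; repeat (case: ifP); nlia.
Qed.

Lemma bcycle_cut L c e : bcycle L.+1 c e -> bpath L c e.
Proof.
move=> [cI eI ce]; split.
- by move=> i j iL jL; apply: cI.
- by move=> i j iL jL; apply: eI; nlia.
- by move=> i iL; have [|? ?] := ce i; rewrite /nx ?ltnS ?iL //; nlia.
Qed.

(* If [h] is itself an edge of the cycle, the cycle is opened at [h]. *)
Lemma bcycle_attach L c e w h j :
  bcycle L c e -> j < L -> (forall i, i < L -> c i <> w) ->
  h \in H -> w \in h -> c j \in h ->
  exists v' e', [/\ bpath L v' e', v' 0 = w, e' 0 = h,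
    forall i, 0 < i <= L -> exists2 a, a < L & v' i = c a
  & forall i, 0 < i < L -> exists2 a, a < L & e' i = e a].
Proof.
case: L => // L cyc jL cw hH wh cjh.
have [r rL [cr er]] : exists2 r, r < L.+1 &
    c r \in h /\ forall i, i < L -> e (rotn L.+1 r i) <> h.
  have [cI eI ce] := cyc.
  have [/existsP[a /eqP ea]|/existsPn ne] :=
      boolP [exists a : 'I_L.+1, e a == h].
    have [_ _ h2] := ce a (ltn_ord a); exists (nx L.+1 a).
      exact: ltn_nx.
    split=> [|i iL E]; first by rewrite -ea.
    have aL := ltn_ord a.
    have : rotn L.+1 (nx L.+1 a) i = a.
      apply: eI; rewrite ?E ?ea //.
      by rewrite /rotn /nx; repeat case: ifP; nlia.
    by rewrite /rotn /nx; repeat case: ifP; nlia.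
  exists j => //; split=> // i iL E.
  have rL : rotn L.+1 j i < L.+1 by rewrite /rotn; case: ifP; nlia.
  by have := ne (Ordinal rL); rewrite /= E eqxx.
have rotL i : i < L.+1 -> rotn L.+1 r i < L.+1.
  by rewrite /rotn; case: ifP; nlia.
have P := bcycle_cut (bcycle_rot cyc rL).
exists (fun i => if i is j.+1 then c (rotn L.+1 r j) else w),
       (fun i => if i is j.+1 then e (rotn L.+1 r j) else h); split=> //.
- apply: bpath_cons P _ _ _ _ er => // [i iL|]; first exact/cw/rotL.
  by rewrite /rotn add0n rL.
- by case=> // i iL; exists (rotn L.+1 r i) => //; apply: rotL; nlia.
- by case=> // i iL; exists (rotn L.+1 r i) => //; apply: rotL; nlia.
Qed.

(** Position [i.+1] meets only the cycle edges [e i] and [e i.+1], and both contain [w]. *)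
Lemma bcycle_swap L c e w i :
  bcycle L c e -> i.+1 < L -> (forall j, j < L -> c j <> w) ->
  w \in e i -> w \in e i.+1 ->
  bcycle L (fun x => if x == i.+1 then w else c x) e.
Proof.
move=> [cI eI ce] iL cw wi wi1; split=> //.
- move=> x y xL yL; case: eqP => [->|nx']; case: eqP => [->|ny'] //.
  + by move/esym/cw => h; case: h.
  + by move/cw => h; case: h.
  + exact: cI.
- move=> x xL; have [? h1 h2] := ce x xL; split=> //; first by case: eqP => [->|].
  case: eqP => // E; have -> // : x = i.
  by move: E; rewrite /nx; case: ifP; nlia.
Qed.

End Constructions.

(** * A binomial inequality and its one exceptional case *)

Lemma bin2_double n : 2 * 'C(n, 2) = n * n.-1.
Proof. by elim: n => // n IHn; rewrite binS bin1; nia. Qed.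

(** Write [k = a + d + 1]. Twice the difference of the two binomials is [(d + 1) * (2 * a + d)],
    while [m <= 2 * (d + 1)]; hence [2 * a + d < 4], and [3 < k] leaves only [a = 0], [d = 3]. *)
Lemma bin2_slack k a m : 3 < k -> 2 * a + m <= 2 * k ->
  'C(k, 2) < 'C(a, 2) + m -> [/\ k = 4, a = 0 & 6 < m].
Proof.
move=> k3 am; have := bin2_double k; have := bin2_double a.
move: 'C(k, 2) 'C(a, 2) => x y ey ex lt.
have ak : a < k.
  rewrite ltnNge; apply/negP => ka.
  have ? : a = k by lia.
  by subst a; lia.
have [d kE] : exists d, k = a + d.+1 by exists (k - a).-1; lia.
subst k.
have key : 2 * x = a * a.-1 + d.+1 * (2 * a + d).
  by rewrite ex addnS /=; case: (a) => [|b] /=; nia.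
have small : 2 * a + d < 4.
  rewrite ltnNge; apply/negP => ge4.
  by have := leq_mul (leqnn d.+1) ge4; lia.
have a0 : a = 0 by lia.
have d3 : d = 3 by lia.
by subst; split=> //; lia.
Qed.

(** * Counting edges through a vertex of a 3-graph *)

Section ThreeGraph.

Variables (T : finType) (H : {set {set T}}).
Hypothesis hH : is_3graph H.
Implicit Types (v c : nat -> T) (e : nat -> {set T}).

Lemma edge3E f x y z : f \in H -> x \in f -> y \in f -> z \in f ->
  x != y -> x != z -> y != z -> f = [set x; y; z].
Proof.
move=> fH xf yf zf xy xz yz; apply/esym/eqP; rewrite eqEcard; apply/andP; split.
  by apply/subsetP => u; rewrite !inE -orbA => /or3P[] /eqP->.
by rewrite (hH fH) setUC cardsU1 cards2 !inE !(eq_sym z) (negPf xz) (negPf yz) xy.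
Qed.

(** Deleting [x] maps these edges injectively to pairs in [A]. *)
Lemma card_star_in x (A : {set T}) :
  #|[set f in H | (x \in f) && (f \subset x |: A)]| <= 'C(#|A|, 2).
Proof.
rewrite -cards_draws; set S := [set f in H | _].
rewrite -(card_in_imset (D := S) (f := fun f : {set T} => f :\ x)); last first.
  move=> f g; rewrite !inE => /and3P[_ xf _] /and3P[_ xg _] E.
  by rewrite -(setD1K xf) -(setD1K xg) E.
apply/subset_leq_card/subsetP => _ /imsetP[f + ->].
rewrite !inE => /and3P[fH xf /subsetP fA]; apply/andP; split.
  apply/subsetP => u; rewrite !inE => /andP[ux /fA].
  by rewrite !inE (negPf ux).
by have := cardsD1 x f; rewrite (hH fH) xf; lia.
Qed.

End ThreeGraph.

(** * Consequences of having no Berge path of length [t + 1], with connectivity as an edge across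
    every cut *)

Section Extremal.

Variables (T : finType) (H : {set {set T}}) (k t : nat).
Implicit Types (v c : nat -> T) (e : nat -> {set T}).

Hypothesis hH : is_3graph H.
Hypothesis k_gt3 : 3 < k.
Hypothesis deg_gt : forall x, 'C(k, 2) < vertex_degree H x.
Hypothesis conn : forall (C : {set T}) x y, x \in C -> y \notin C ->
  exists h a b, [/\ h \in H, a \in h, a \in C, b \in h & b \notin C].
Hypothesis t_le : t <= 2 * k.
Hypothesis T_gt : 2 * k + 1 < #|T|.
Hypothesis no_longer : forall v e, ~ bpath H t.+1 v e.

(** Otherwise [u], joined to [v 0] by [f], would prolong the path. *)
Lemma end_edge_in_path v e f u : bpath H t v e -> f \in H -> v 0 \in f ->
  (forall i, i < t -> e i <> f) -> u \in f -> exists2 i, i <= t & u = v i.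
Proof.
move=> P fH f0 ef uf.
have [/existsP[i /eqP vi]|/existsPn nu] := boolP [exists i : 'I_t.+1, v i == u].
  by exists i => //; rewrite -ltnS.
case: (no_longer (bpath_cons P _ fH uf f0 ef)) => i it.
by apply/eqP; apply: (nu (Ordinal (it : i < t.+1))).
Qed.

(** The common form of the degree estimates: exceptional edges in [B] count one by one, all others
    as pairs in [A]. *)
Lemma deg_le_union x (B : {set {set T}}) (A : {set T}) :
  (forall f, f \in H -> x \in f -> f \notin B -> f \subset x |: A) ->
  vertex_degree H x <= 'C(#|A|, 2) + #|B|.
Proof.
move=> hB; apply: leq_trans (leq_add (card_star_in hH x A) (leqnn #|B|)).
apply: leq_trans (leq_card_setU _ _); apply/subset_leq_card/subsetP => f.
rewrite !inE => /andP[fH xf]; rewrite fH xf /=.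
by case: (boolP (f \in B)) => fB; rewrite ?orbT // hB.
Qed.

(** If [t < k], the off-path edges at [v 0] stay among the path vertices, so its degree is at most
    ['C(t, 2) + t = 'C(t.+1, 2) <= 'C(k, 2)]. *)
Lemma longest_length v e : bpath H t v e -> k <= t.
Proof.
move=> P; rewrite leqNgt; apply/negP => tk.
set A := [set v (i : 'I_t).+1 | i in 'I_t].
set E := [set e (i : 'I_t) | i in 'I_t].
have : vertex_degree H (v 0) <= 'C(#|A|, 2) + #|E|.
  apply: deg_le_union => f fH f0 fE; apply/subsetP => u uf.
  have [|[|i] it ->] := end_edge_in_path P fH f0 _ uf; last 2 first.
  - by rewrite !inE eqxx.
  - by rewrite !inE; apply/orP; right; apply/imsetP; exists (Ordinal it).
  move=> i it E'; case/negP: fE; apply/imsetP.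
  by exists (Ordinal it).
have cA : #|A| <= t by apply: leq_trans (leq_imset_card _ _) _; rewrite card_ord.
have cE : #|E| <= t by apply: leq_trans (leq_imset_card _ _) _; rewrite card_ord.
have := leq_bin2l 2 tk; have := leq_bin2l 2 cA; have := deg_gt (v 0).
by rewrite binS bin1; nlia.
Qed.

Lemma cycle_neighbour L c : 0 < L -> L < #|T| -> exists h w j,
  [/\ h \in H, w \in h, forall i, i < L -> c i <> w, j < L & c j \in h].
Proof.
move=> L0 LT; set C := [set c (i : 'I_L) | i in 'I_L].
have CT : #|C| < #|T|.
  by apply: leq_ltn_trans (leq_imset_card _ _) _; rewrite card_ord.
have [y yC] : exists y, y \notin C.
  apply/existsP; rewrite -negb_forall; apply: contraL CT => /forallP yC.
  rewrite -leqNgt -cardsT; apply/subset_leq_card/subsetP => y _; exact: yC.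
have xC : c 0 \in C by apply/imsetP; exists (Ordinal L0).
have [h [a [b [hh ah /imsetP[j _ aj] bh bC]]]] := conn xC yC.
exists h, b, j; split; rewrite -?aj //.
by move=> i iL E; case/negP: bC; apply/imsetP; exists (Ordinal iL).
Qed.

(** Since [t.+1 <= 2 * k + 1 < #|T|], some edge leaves the cycle; entering the cycle through it and
    running round gives a path of length [t.+1]. *)
Lemma no_spanning_cycle c e : ~ bcycle H t.+1 c e.
Proof.
move=> cyc.
have [//||h [w [j [hh wh cw jL cj]]]] := @cycle_neighbour t.+1 c; first nlia.
have [v' [e' [P _ _ _ _]]] := bcycle_attach cyc jL cw hh wh cj.
exact: no_longer P.
Qed.

(** If [f] had a vertex [u] elsewhere, the path from [u] through [w] into and around the cycle would
    have length [t.+1]. It needs two distinct edges at [w], whence the case [h = f]. *)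
Lemma outside_star_in_cycle c e w h j : bcycle H t c e ->
  (forall i, i < t -> c i <> w) -> h \in H -> w \in h -> j < t -> c j \in h ->
  forall f u, f \in H -> w \in f -> u \in f ->
  u = w \/ exists2 i, i < t & u = c i.
Proof.
move=> cyc cw hh wh jt cj f u fH wf uf.
have [//|nuw] := eqVneq u w; first by left.
have [/existsP[i /eqP ->]|/existsPn nu] := boolP [exists i : 'I_t, u == c i].
  by right; exists i.
have [cI eI ce] := cyc.
have kt : k <= t.
  have [v' [e' [P _ _ _ _]]] := bcycle_attach cyc jt cw hh wh cj.
  exact: longest_length P.
(* An edge through [w] with a vertex off the cycle extends every path that enters
   the cycle from [w] through another edge. *)
have ext f1 u1 h1 j1 : f1 \in H -> w \in f1 -> u1 \in f1 -> u1 != w ->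
    (forall i, i < t -> u1 <> c i) -> (forall i, i < t -> e i <> f1) ->
    h1 \in H -> w \in h1 -> j1 < t -> c j1 \in h1 -> h1 <> f1 -> False.
  move=> f1H wf1 uf1 u1w u1c ef1 h1H wh1 j1t cj1 hf1.
  have [v' [e' [P v0 e0 vc ec]]] := bcycle_attach cyc j1t cw h1H wh1 cj1.
  apply: (no_longer (bpath_cons P _ f1H uf1 _ _)); rewrite ?v0 //.
  - move=> [_|i it]; first by rewrite v0; apply/nesym/eqP.
    by have [|a at_ ->] := vc i.+1; [nlia | apply/nesym/u1c].
  - move=> [_|i it]; first by rewrite e0.
    by have [|a at_ ->] := ec i.+1; [nlia | apply: ef1].
(* A cycle edge through [w] already consists of [w] and two consecutive cycle vertices, leaving no
   room for [u1]. *)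
have off f1 u1 : f1 \in H -> w \in f1 -> u1 \in f1 -> u1 != w ->
    (forall i, i < t -> u1 <> c i) -> forall i, i < t -> e i <> f1.
  move=> f1H wf1 uf1 u1w u1c i it E; have [_ ci cn] := ce i it.
  have nt := ltn_nx it.
  have ni : c i != c (nx t i).
    by apply/eqP => /(cI _ _ it nt); rewrite /nx; case: ifP; nlia.
  have wi : w != c i by apply/eqP/nesym/cw.
  have wn : w != c (nx t i) by apply/eqP/nesym/cw.
  rewrite E in ci cn; move: uf1.
  rewrite (edge3E hH f1H wf1 ci cn wi wn ni) !inE (negPf u1w) /=.
  by case/orP => /eqP; apply: u1c.
have uc i : i < t -> u <> c i by move=> it; apply/eqP/(nu (Ordinal it)).
have ef := off f u fH wf uf nuw uc.
have [hf|/eqP nhf] := eqVneq h f; last first.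
  by case: (ext f u h j fH wf uf nuw uc ef hh wh jt cj nhf).
(* [h] is the only edge at hand into the cycle, but [w] lies on a second edge [q]. *)
have [q] : exists q, q \in [set q in H | w \in q] :\ f.
  apply/set0Pn; rewrite -card_gt0.
  have := deg_gt w; rewrite /vertex_degree (cardsD1 f) inE fH wf /=.
  have : 1 < 'C(k, 2) by apply: leq_trans (leq_bin2l 2 k_gt3).
  by set n1 := 'C(k, 2); set n2 := #|_|; nlia.
rewrite !inE => /and3P[/eqP qf qH wq].
have [/existsP[b cb]|/existsPn ncb] := boolP [exists b : 'I_t, c b \in q].
  by case: (ext f u q b fH wf uf nuw uc ef qH wq (ltn_ord b) cb qf).
have [z zq] : exists z, z \in q :\ w.
  apply/set0Pn; rewrite -card_gt0.
  by have := cardsD1 w q; rewrite (hH qH) wq; set n2 := #|_|; nlia.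
move: zq; rewrite !inE => /andP[zw zq].
have zc i : i < t -> z <> c i.
  by move=> it E; have := ncb (Ordinal it); rewrite /= -E zq.
have eq_ := off q z qH wq zq zw zc.
by case: (ext q z h j qH wq zq zw zc eq_ hh wh jt cj) => E; apply: qf; rewrite -hf -E.
Qed.

(** * A vertex [w] off a cycle of length [t] *)

Section CycleOfLengthT.

Variables (c : nat -> T) (e : nat -> {set T}) (w : T).
Hypothesis cyc : bcycle H t c e.
Hypothesis cw : forall i, i < t -> c i <> w.
Hypothesis w_near :
  exists h j, [/\ h \in H, w \in h, j < t & c j \in h].

(** The only possible edge joining [w] to both [c i] and its successor. *)
Let tri i : {set T} := [set w; c i; c (nx t i)].

Let nxo (a : 'I_t) : 'I_t := Ordinal (ltn_nx (ltn_ord a)).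

Let nxo_inj : injective nxo.
Proof.
by move=> a b /(congr1 val) /= /(nx_inj (ltn_ord a) (ltn_ord b)) /val_inj.
Qed.

Let kt : k <= t.
Proof.
have [h [j [hh wh jt cj]]] := w_near.
have [v' [e' [P _ _ _ _]]] := bcycle_attach cyc jt cw hh wh cj.
exact: longest_length P.
Qed.

Let nx_neq i : i < t -> nx t i <> i.
Proof. by rewrite /nx; case: ifP; nlia. Qed.

Let triE f i : i < t -> f \in H -> w \in f -> c i \in f -> c (nx t i) \in f ->
  f = tri i.
Proof.
move=> it fH wf ci cn; have [cI _ _] := cyc.
apply: (edge3E hH) => //; try by apply/eqP/nesym/cw; rewrite ?ltn_nx.
by apply/eqP => /(cI _ _ it (ltn_nx it)) /esym; apply: nx_neq.
Qed.

Let mem_tri i j : i < t -> j < t -> c i \in tri j -> i = j \/ i = nx t j.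
Proof.
move=> it jt; have [cI _ _] := cyc; rewrite !inE -orbA.
case/or3P=> /eqP; first by move/cw; case.
  by move/(cI _ _ it jt); left.
by move/(cI _ _ it (ltn_nx jt)); right.
Qed.

Let tri_inj i j : i < t -> j < t -> tri i = tri j -> i = j.
Proof.
move=> it jt E.
have [//|ij] : i = j \/ i = nx t j by apply: mem_tri; rewrite // -E !inE eqxx orbT.
have [nij|nij] : nx t i = j \/ nx t i = nx t j.
- by apply: mem_tri; rewrite ?ltn_nx // -E !inE eqxx orbT.
(* Two positions succeeding each other would force [t <= 2]. *)
- by move: ij nij kt; rewrite /nx; do 2 case: ifP; nlia.
- exact: nx_inj nij.
Qed.

Let edge_tri i : i < t -> w \in e i -> e i = tri i.
Proof. by move=> it wi; have [_ _ /(_ i it)[? ? ?]] := cyc; apply: triE. Qed.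

Let edge_eq_tri i a : i < t -> a < t -> e i = tri a -> i = a.
Proof.
move=> it at_ E; apply: tri_inj => //; rewrite -E.
by apply/esym/edge_tri; rewrite // E !inE eqxx.
Qed.

Let no_insert a f g : a < t -> f \in H -> w \in f -> c a \in f ->
  g \in H -> w \in g -> c (nx t a) \in g -> f <> g ->
  (forall i, i < t -> e i = f -> i = a) ->
  (forall i, i < t -> e i = g -> i = a) -> False.
Proof.
move=> at_ fH wf cf gH wg cg fg ef eg.
exact: no_spanning_cycle (bcycle_insert cyc at_ cw fH cf wf gH wg cg fg ef eg).
Qed.

(** [M] marks the edges from [w] to consecutive vertices, [A] the cycle vertices on other edges at
    [w], and [B] the predecessors of [A]. Any overlap of two of these sets would let [w] be
    inserted, so [2 * #|A| + #|M| <= t], and [bin2_slack] applies to the degree of [w]. *)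
Lemma wheel : [/\ k = 4, t <= 8 & 6 <= #|[set a : 'I_t | w \in e a]|].
Proof.
have [h [j [hh wh jt cj]]] := w_near.
have star := outside_star_in_cycle cyc cw hh wh jt cj.
pose cons (f : {set T}) := [exists a : 'I_t, f == tri a].
pose M := [set a : 'I_t | tri a \in H].
pose A := [set a : 'I_t |
  [exists f in H, [&& w \in f, c a \in f & ~~ cons f]]].
pose B := nxo @^-1: A.
have AP a : a \in A -> exists f, [/\ f \in H, w \in f, c a \in f,
    forall i : 'I_t, f <> tri i & forall i, i < t -> e i <> f].
  rewrite inE => /existsP[f /and4P[fH wf ca /existsPn ncf]].
  exists f; split=> // [i|i it E]; first exact/eqP/ncf.
  have /negP := ncf (Ordinal it); apply; rewrite -E /=.
  by apply/eqP/edge_tri; rewrite // E.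
have MP a : a \in M -> [/\ tri a \in H, w \in tri a, c a \in tri a &
    c (nx t a) \in tri a].
  by rewrite inE => ?; split=> //; rewrite !inE eqxx ?orbT.
have dAM : [disjoint A & M].
  apply/pred0Pn => -[a /= /andP[/AP[f [fH wf ca nf ef]] /MP[tH wt tc tn]]].
  apply: (no_insert (ltn_ord a) fH wf ca tH wt tn (nf a)) => i it E.
    by case: (ef i it).
  exact: edge_eq_tri E.
have dBM : [disjoint B & M].
  apply/pred0Pn => -[a /= /andP[+ /MP[tH wt tc tn]]].
  rewrite inE => /AP[f [fH wf ca nf ef]].
  apply: (no_insert (ltn_ord a) tH wt tc fH wf ca (nesym (nf a))) => i it E.
    exact: edge_eq_tri E.
  by case: (ef i it).
have dAB : [disjoint A & B].
  apply/pred0Pn => -[a /= /andP[/AP[f [fH wf ca nf ef]]]].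
  rewrite inE => /AP[g [gH wg cg ng eg]].
  apply: (no_insert (ltn_ord a) fH wf ca gH wg cg) => [E|i it E|i it E].
  - by apply: (nf a); apply: triE; rewrite // E.
  - by case: (ef i it).
  - by case: (eg i it).
have cAB : 2 * #|A| + #|M| <= t.
  have := subset_leq_card (subsetT (A :|: B :|: M)).
  rewrite cardsT card_ord !cardsU (card_preimset _ nxo_inj).
  rewrite setIUl (disjoint_setI0 dAB) (disjoint_setI0 dAM) (disjoint_setI0 dBM).
  by rewrite setU0 cards0; nlia.
have degw : vertex_degree H w <=
    'C(#|[set c (a : 'I_t) | a in A]|, 2) + #|[set tri (a : 'I_t) | a in M]|.
  apply: deg_le_union => f fH wf fM; apply/subsetP => u uf; rewrite !inE.
  case: (star f u fH wf uf) => [->|[i it ui]]; first by rewrite eqxx.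
  apply/orP; right; apply/imsetP; exists (Ordinal it) => //.
  rewrite inE; apply/existsP; exists f; rewrite fH wf -ui uf /=.
  apply: contra fM => /existsP[a /eqP fa]; apply/imsetP; exists a => //.
  by rewrite inE -fa.
have [k4 A0 M6] : [/\ k = 4, #|A| = 0 & 6 < #|M|].
  apply: bin2_slack => //; first by nlia.
  apply: leq_trans (deg_gt w) (leq_trans degw _); apply: leq_add.
    exact/leq_bin2l/leq_imset_card.
  exact: leq_imset_card.
split=> //; first by nlia.
(* It remains to see that most triangles in [M] are cycle edges. If [tri a] is not one, it is free
   for inserting [w] after the successor of [a], so that successor is not in [M]. Hence
   [#|F| <= 8 - 7]. *)
pose F := [set a in M | tri a != e a].
have FM : nxo @: F \subset ~: M.
  apply/subsetP => _ /imsetP[a + ->]; rewrite inE => /andP[aM /eqP ta].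
  have [tH wt _ tn] := MP a aM; rewrite inE; apply/negP => /MP[tH' wt' tc' tn'].
  apply: (no_insert (ltn_ord (nxo a)) tH wt tn tH' wt' tn') => [E|i it E|i it E].
  - by have /nx_neq := ltn_ord a; apply; apply/esym/tri_inj; rewrite ?ltn_nx.
  - case: ta; rewrite -E; congr (e _); apply/esym.
    by rewrite (edge_eq_tri it _ E).
  - exact: edge_eq_tri E.
have cF : #|F| + #|M| <= t.
  have := subset_leq_card FM; rewrite (card_imset _ nxo_inj).
  by have := cardsC M; rewrite card_ord; nlia.
have cW : #|M :\: F| <= #|[set a : 'I_t | w \in e a]|.
  apply/subset_leq_card/subsetP => a; rewrite !inE => /andP[+ aM].
  by rewrite aM /= negbK => /eqP <-; rewrite !inE eqxx.
have := cardsD M F; rewrite (setIidPr _); first by nlia.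
by apply/subsetP => a; rewrite inE => /andP[].
Qed.

End CycleOfLengthT.

(** The hub [w] changes places with a rim vertex [c i.+1]. The new cycle has the same edges, so both
    vertices lie on at least six of them and share at least four; but a cycle edge through [w]
    contains [c i.+1] only at positions [i] and [i.+1]. *)
Lemma no_cycle_t c e : 0 < t -> ~ bcycle H t c e.
Proof.
move=> t0 cyc; have [cI eI ce] := cyc.
have [//||h [w [j [hh wh cw jt cj]]]] := @cycle_neighbour t c; first nlia.
have [k4 t8 W6] : [/\ k = 4, t <= 8 & 6 <= #|[set a : 'I_t | w \in e a]|].
  by apply: wheel cyc cw _; exists h, j.
set W := [set a : 'I_t | w \in e a] in W6.
pose nxo (a : 'I_t) : 'I_t := Ordinal (ltn_nx (ltn_ord a)).
have nxo_inj : injective nxo.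
  by move=> a b /(congr1 val) /= /(nx_inj (ltn_ord a) (ltn_ord b)) /val_inj.
(* Among at most eight positions the overlap is at least [6 + 6 - 8]. *)
have inter6 (X Y : {set 'I_t}) : 6 <= #|X| -> 6 <= #|Y| -> 4 <= #|X :&: Y|.
  have := cardsUI X Y; have := subset_leq_card (subsetT (X :|: Y)).
  by rewrite cardsT card_ord; nlia.
have lastP : t.-1 < t by nlia.
(* The last position is removed so that the successor of [i] is [i.+1], without wrapping round. *)
have [i] : exists i, i \in (W :&: nxo @^-1: W) :\ Ordinal lastP.
  apply/set0Pn; rewrite -card_gt0.
  have : 4 <= #|W :&: nxo @^-1: W|.
    by apply: inter6; rewrite ?(card_preimset _ nxo_inj).
  by rewrite (cardsD1 (Ordinal lastP)); case: (_ \in _) => /=; nlia.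
rewrite !inE => /and3P[ni wi wni].
have it : i.+1 < t.
  have := ltn_ord i; suff : i <> t.-1 :> nat by nlia.
  by move=> E; case/negP: ni; apply/eqP/val_inj.
have nxE : nx t i = i.+1 by rewrite /nx it.
rewrite /= nxE in wni.
have cyc' := bcycle_swap cyc it cw wi wni.
set c' := (fun x => _) in cyc'.
have [eiH ci cn] := ce i (ltn_ord i); rewrite nxE in cn.
have [_ _ V6] : [/\ k = 4, t <= 8 & 6 <= #|[set a : 'I_t | c i.+1 \in e a]|].
  apply: wheel cyc' _ _ => [a at_|].
    rewrite /c'; case: eqP => [_|na]; first exact/nesym/cw.
    by move/(cI _ _ at_ it).
  exists (e i), i; split=> //.
  by rewrite /c'; case: eqP => // E; move: E; nlia.
have := inter6 _ _ W6 V6; set X := _ :&: _ => X4.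
have : #|X| <= #|[set Ordinal (ltnW it); Ordinal it]|.
  apply/subset_leq_card/subsetP => a; rewrite !inE => /andP[wa ca].
  have at_ := ltn_ord a; have [eaH ca' cna] := ce a at_.
  have nt := ltn_nx at_.
  have := edge3E hH eaH wa ca' cna.
  have neq b : b < t -> w != c b by move=> bt; apply/eqP/nesym/cw.
  have nn : c a != c (nx t a).
    by apply/eqP => /(cI _ _ at_ nt); rewrite /nx; case: ifP; nlia.
  move=> /(_ (neq _ at_) (neq _ nt) nn) E.
  move: ca; rewrite E !inE eq_sym (negPf (neq _ it)) /= => /orP[]/eqP.
    by move/(cI _ _ it at_) => E'; apply/orP; right; apply/eqP/val_inj.
  move/(cI _ _ it nt) => E'; apply/orP; left; apply/eqP/val_inj => /=.
  by move: E'; rewrite /nx; case: ifP; nlia.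
by rewrite cards2; case: (_ != _); nlia.
Qed.

(** * Crossing argument at the two ends of a longest path *)

(* The slots [a] for which the first vertex can be joined to [v a.+1] once [e a]
   is deleted. *)
Definition slots v e : {set 'I_t} := [set a : 'I_t |
  [exists f in H, [&& v 0 \in f, v a.+1 \in f &
     (f == e a) || [forall b : 'I_t, f != e b]]]].

Lemma slotsP v e (a : 'I_t) : reflect
  (exists f, [/\ f \in H, v 0 \in f, v a.+1 \in f &
     f = e a \/ forall b, b < t -> e b <> f])
  (a \in slots v e).
Proof.
rewrite inE; apply: (iffP existsP) => -[f].
  case/and4P=> fH f0 fa E; exists f; split=> //.
  case/orP: E => [/eqP|/forallP nf]; [by left | right=> b bt E].
  by have := nf (Ordinal bt); rewrite -E eqxx.
case=> fH f0 fa E; exists f; rewrite fH f0 fa /=.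
case: E => [->|nf]; first by rewrite eqxx.
by apply/orP; right; apply/forallP => b; apply/eqP/nesym/nf.
Qed.

Lemma slots_first_edge v e a : bpath H t v e -> a < t -> v 0 \in e a ->
  exists2 a' : 'I_t, a' = a :> nat & a' \in slots v e.
Proof.
move=> [vI eI ve] at_ v0; exists (Ordinal at_) => //; apply/slotsP.
by exists (e a); have [? ? ?] := ve a at_; split=> //; left.
Qed.

Lemma slots_star v e f u : bpath H t v e -> f \in H -> v 0 \in f ->
  (forall b, b < t -> e b <> f) -> u \in f ->
  u = v 0 \/ exists2 a : 'I_t, a \in slots v e & u = v a.+1.
Proof.
move=> P fH f0 ef uf.
have [[|i] it ui] := end_edge_in_path P fH f0 ef uf; first by left.
right; exists (Ordinal it) => //; apply/slotsP; exists f.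
by split; rewrite -?ui //; right.
Qed.

(** With [s] slots, the path edges at [v 0] are among [s] edges and the others lie in [v 0] and [s]
    further vertices. If [s < k], the degree is at most ['C(s, 2) + s = 'C(s.+1, 2) <= 'C(k, 2)]. *)
Lemma card_slots v e : bpath H t v e -> k <= #|slots v e|.
Proof.
move=> P; set S := slots v e.
have degv : vertex_degree H (v 0) <=
    'C(#|[set v (a : 'I_t).+1 | a in S]|, 2) + #|[set e (a : 'I_t) | a in S]|.
  apply: deg_le_union => f fH f0 fE; apply/subsetP => u uf; rewrite !inE.
  have ef b : b < t -> e b <> f.
    move=> bt E; case/negP: fE; rewrite -E in f0 *.
    have [a <- aS] := slots_first_edge P bt f0.
    by apply/imsetP; exists a.
  have [->|[a aS ->]] := slots_star P fH f0 ef uf; first by rewrite eqxx.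
  by apply/orP; right; apply/imsetP; exists a.
rewrite leqNgt; apply/negP => sk.
have cA : #|[set v (a : 'I_t).+1 | a in S]| <= #|S| by exact: leq_imset_card.
have cE : #|[set e (a : 'I_t) | a in S]| <= #|S| by exact: leq_imset_card.
have := leq_bin2l 2 sk; rewrite binS bin1.
by have := leq_bin2l 2 cA; have := deg_gt (v 0); nlia.
Qed.

(* By disjointness the slots of the two ends fill all [2 * k] slots, and the
   absence of a cycle of length [t] makes the slots of the first end an initial
   segment. *)
Lemma longest_path_structure v e : bpath H t v e ->
  t = 2 * k /\ forall f u, f \in H -> v 0 \in f -> f <> e 0 -> u \in f ->
    exists2 i, i <= k & u = v i.
Proof.
move=> P; have [vI eI ve] := P; have kt := longest_length P.
have Q := bpath_rev P; have t0 : 0 < t by nlia.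
(* Index reversal puts both sets on the same path edges: [b] in [R] means that [v t] can be joined
   to [v b] once [e b] is deleted. *)
set S := slots v e; pose R : {set 'I_t} := @rev_ord t @^-1:
  slots (fun i => v (t - i)) (fun i => e (t - i.+1)).
have cS : k <= #|S| := card_slots P.
have cR : k <= #|R|.
  by rewrite (card_preimset _ rev_ord_inj); apply: card_slots Q.
have RP (a : 'I_t) : a \in R -> exists g, [/\ g \in H, v t \in g, v a \in g &
     g = e a \/ forall b, b < t -> e b <> g].
  rewrite inE => /slotsP[g]; rewrite /= subn0.
  have at_ := ltn_ord a.
  have -> : t - (t - a.+1).+1 = a by nlia.
  case=> gH gt ga E; exists g; split=> //; case: E => [|ng]; [by left | right].
  move=> b bt; have := ng (t - b.+1); have -> : t - (t - b.+1).+1 = b by nlia.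
  by apply; nlia.
have no_close f : f \in H -> v 0 \in f -> v t \in f -> exists2 b, b < t & e b = f.
  move=> fH f0 ft.
  have [/existsP[b /eqP]|/existsPn ne] := boolP [exists b : 'I_t, e b == f].
    by exists b.
  case: (no_spanning_cycle (bpath_close P fH f0 ft _)) => b bt.
  by apply/eqP; apply: (ne (Ordinal bt)).
(* The crossing cycle has length [t.+1] if [a = b] and [t] if [a = b.+1]; both are excluded. *)
have cross (a b : 'I_t) : a \in S -> b \in R -> b <= a <= b.+1 -> False.
  move=> /slotsP[f [fH f0 fa Ef]] /RP[g [gH gt gb Eg]] ab.
  have at_ := ltn_ord a; have bt := ltn_ord b.
  have [E|/eqP fg] := eqVneq f g; last first.
    have efa x : x < t -> e x = f -> b <= x < a.+1.
      by case: Ef => [->|nf] xt; [move/(eI _ _ xt at_); nlia | move/(nf _ xt)].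
    have ega x : x < t -> e x = g -> b <= x < a.+1.
      by case: Eg => [->|ng] xt; [move/(eI _ _ xt bt); nlia | move/(ng _ xt)].
    have ba : b < a.+1 by nlia.
    have := bpath_cross P ba at_ fH f0 fa gH gt gb fg efa ega.
    have [ab'|ab'] : a = b :> nat \/ a = b.+1 :> nat by nlia.
      have -> : t + b + 2 - a.+1 = t.+1 by nlia.
      exact: no_spanning_cycle.
    have -> : t + b + 2 - a.+1 = t by nlia.
    by apply: no_cycle_t; nlia.
  (* If [f = g], this edge contains both ends, so it is a path edge, namely [e a]. Having three
     vertices, it must be the first or the last one, and then it closes a cycle of length [t]. *)
  rewrite -E in gH gt gb Eg => {gH}.
  have [x xt ex] := no_close f fH f0 gt.
  case: Ef => [fE|/(_ x xt) //]; case: Eg => [fE'|/(_ x xt) //].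
  have ab' : a = b :> nat by apply: eI; rewrite // -fE -fE'.
  have [a0|a0] := posnP a.
    have vt : v (t - 0) \in e (t - t.-1.+1).
      have -> : t - t.-1.+1 = a by nlia.
      by rewrite subn0 -fE.
    exact: no_cycle_t t0 (bpath_close_last Q t0 vt).
  have neq i j : i <= t -> j <= t -> i <> j -> v i != v j.
    by move=> it jt ij; apply/eqP => /(vI _ _ it jt).
  have [_ va _] := ve a at_; rewrite -fE in va.
  have fE3 : f = [set v 0; v a; v a.+1].
    by apply: (edge3E hH) => //; apply: neq; nlia.
  have at1 : a = t.-1 :> nat.
    move: gt; rewrite fE3 !inE -orbA => /or3P[]/eqP/vI; nlia.
  rewrite fE at1 in f0.
  exact: no_cycle_t t0 (bpath_close_last P t0 f0).
have dSR : [disjoint S & R].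
  apply/pred0Pn => -[a /= /andP[aS aR]].
  by apply: (cross a a); rewrite // leqnn leqnSn.
have cSR := subset_leq_card (subsetT (S :|: R)).
rewrite cardsT card_ord cardsU (disjoint_setI0 dSR) cards0 in cSR.
have t2k : t = 2 * k by nlia.
have Sk : #|S| = k by nlia.
have SRC : R = ~: S.
  apply/eqP; rewrite eqEcard; apply/andP; split.
    by rewrite -disjoints_subset disjoint_sym.
  by have := cardsC S; rewrite card_ord; nlia.
(* If [a] is in [S] but [a.-1] is not, then [a.-1] is in [R], against [cross]. *)
have Sdown m : forall a b : 'I_t, a = b + m :> nat -> a \in S -> b \in S.
  elim: m => [|m IHm] a b ab aS.
    by have -> : b = a by apply: val_inj; rewrite /= ab addn0.
  have at_ := ltn_ord a.
  have a't : a.-1 < t by nlia.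
  apply: (IHm (Ordinal a't)); first by rewrite /= ab; nlia.
  apply/negPn/negP => nS; apply: (cross a (Ordinal a't) aS).
    by rewrite SRC inE.
  by rewrite /=; nlia.
have Slt (a : 'I_t) : a \in S -> a < k.
  move=> aS; have at_ := ltn_ord a; rewrite -Sk.
  have <- : #|[set widen_ord at_ x | x in 'I_a.+1]| = a.+1.
    rewrite card_imset ?card_ord //; by move=> x y /(congr1 val) /= /val_inj.
  apply/subset_leq_card/subsetP => _ /imsetP[x _ ->].
  apply: (Sdown (a - x) a) => //=; have := ltn_ord x; nlia.
split=> // f u fH f0 fe0 uf.
(* A path edge [f = e b] with [0 < b] consists of [v 0], [v b], [v b.+1], and [b] is a slot, so
   [b < k]. *)
have [/existsP[b /eqP eb]|/existsPn ne] := boolP [exists b : 'I_t, e b == f].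
  have bt := ltn_ord b; have [_ vb vb1] := ve b bt.
  have b0 : 0 < b.
    by rewrite lt0n; apply/eqP => b0; apply: fe0; rewrite -eb b0.
  rewrite eb in vb vb1.
  have bS : b \in S by apply/slotsP; exists f; split=> //; left.
  have bk := Slt b bS.
  have neq i j : i <= t -> j <= t -> i <> j -> v i != v j.
    by move=> it jt ij; apply/eqP => /(vI _ _ it jt).
  have fE3 : f = [set v 0; v b; v b.+1].
    by apply: (edge3E hH) => //; apply: neq; nlia.
  move: uf; rewrite fE3 !inE -orbA => /or3P[]/eqP->.
  - by exists 0.
  - by exists b => //; nlia.
  - by exists b.+1 => //; nlia.
have ef b : b < t -> e b <> f.
  by move=> bt; apply/eqP; apply: (ne (Ordinal bt)).
have [->|[a aS ->]] := slots_star P fH f0 ef uf; first by exists 0.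
by exists a.+1 => //; apply: Slt.
Qed.

Lemma no_longest v e : bpath H t v e -> False.
Proof.
move=> P; have [vI eI ve] := P; have kt := longest_length P.
have [t2k inside] := longest_path_structure P.
have t0 : 0 < t by nlia.
have [e0H v0e0 v1e0] := ve 0 t0.
have segment (f : {set T}) : (forall u, u \in f -> exists2 i, i <= k & u = v i) ->
    f \subset v 0 |: [set v (i : 'I_k).+1 | i in 'I_k].
  move=> fk; apply/subsetP => u /fk[[|i] ik ->]; rewrite !inE ?eqxx //.
  by apply/orP; right; apply/imsetP; exists (Ordinal ik).
(* Without such an [f], every edge at [v 0] except [e 0] and [e 1] avoids [v 1], so the degree is at
   most ['C(k.-1, 2) + 2], which is less than ['C(k, 2)]. *)
have [f [fH f0 f1 ef]] : exists f, [/\ f \in H, v 0 \in f, v 1 \in f &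
    forall b, b < t -> e b <> f].
  have [/existsP[f]|/existsPn nf] := boolP [exists f : {set T},
      [&& f \in H, v 0 \in f, v 1 \in f & [forall b : 'I_t, e b != f]]].
    case/and4P=> ? ? ? /forallP ne; exists f; split=> // b bt.
    by apply/eqP; apply: (ne (Ordinal bt)).
  have degv : vertex_degree H (v 0) <=
      'C(#|[set v (i : 'I_k.-1).+2 | i in 'I_k.-1]|, 2) + #|[set e 0; e 1]|.
    apply: deg_le_union => f fH f0; rewrite !inE negb_or => /andP[/eqP n0 /eqP n1].
    apply/subsetP => u uf; have [[|[|i]] ik ui] := inside f u fH f0 n0 uf.
    - by rewrite ui !inE eqxx.
    - rewrite ui in uf; have := nf f; rewrite fH f0 uf /= => /forallPn[b].
      rewrite negbK => /eqP eb; have bt := ltn_ord b.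
      have [_ vb vb1] := ve b bt; rewrite eb in vb vb1.
      have b0 : 0 < b by rewrite lt0n; apply/eqP => b0; apply: n0; rewrite -eb b0.
      have b1 : 1 < b.
        by suff : b <> 1 :> nat by [nlia]; move=> b1; apply: n1; rewrite -eb b1.
      have neq i j : i <= t -> j <= t -> i <> j -> v i != v j.
        by move=> it jt ij; apply/eqP => /(vI _ _ it jt).
      have fE : f = [set v 0; v b; v b.+1].
        by apply: (edge3E hH) => //; apply: neq; nlia.
      by move: uf; rewrite fE !inE -orbA => /or3P[]/eqP/vI; nlia.
    - have ik' : i < k.-1 by nlia.
      by rewrite !inE; apply/orP; right; apply/imsetP; exists (Ordinal ik').
  have cA : #|[set v (i : 'I_k.-1).+2 | i in 'I_k.-1]| <= k.-1.
    by apply: leq_trans (leq_imset_card _ _) _; rewrite card_ord.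
  have cE : #|[set e 0; e 1]| <= 2 by rewrite cards2; case: (_ != _).
  have kE : k = k.-1.+1 by nlia.
  have bk : 'C(k, 2) = 'C(k.-1, 2) + k.-1 by rewrite {1}kE binS bin1.
  by have := leq_bin2l 2 cA; have := deg_gt (v 0); nlia.
(* On the new path [e 0] is no longer the first edge, so the structure lemma confines it as well. *)
have P' := bpath_set_first P t0 fH f0 f1 ef.
have [_ inside'] := longest_path_structure P'.
have : vertex_degree H (v 0) <=
    'C(#|[set v (i : 'I_k).+1 | i in 'I_k]|, 2) + #|set0 : {set {set T}}|.
  apply: deg_le_union => g gH g0 _; apply: segment => u ug.
  have [ge|/eqP ge] := eqVneq g (e 0); last exact: inside gH g0 ge ug.
  by apply: inside' gH g0 _ ug; rewrite ge; apply: ef.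
have cA : #|[set v (i : 'I_k).+1 | i in 'I_k]| <= k.
  by apply: leq_trans (leq_imset_card _ _) _; rewrite card_ord.
have := leq_bin2l 2 cA; have := deg_gt (v 0); rewrite cards0; nlia.
Qed.

End Extremal.

(** * Translation between finite-function paths and paths indexed by natural numbers *)

Section Conversion.

Variables (T : finType) (H : {set {set T}}).

Lemma berge_path_of_bpath t v e : bpath H t v e ->
  berge_path H [ffun i : 'I_t.+1 => v i] [ffun i : 'I_t => e i].
Proof.
move=> [vI eI ve]; apply/and3P; split.
- apply/injectiveP => i j; rewrite !ffunE => E; apply: val_inj.
  by apply: vI E; apply: leq_ord.
- apply/injectiveP => i j; rewrite !ffunE => E; apply: val_inj.
  by apply: eI E; apply: ltn_ord.
- apply/forallP => i; have [eH v1 v2] := ve i (ltn_ord i).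
  rewrite !ffunE eH /=; apply/subsetP => u; rewrite !inE.
  by case/orP=> /eqP->.
Qed.

(** Outside the index range, [inord] and [set0] supply filler values. *)
Lemma bpath_of_berge_path t (v : {ffun 'I_t.+1 -> T}) (e : {ffun 'I_t -> {set T}}) :
  berge_path H v e ->
  bpath H t (fun i => v (inord i))
            (fun i => if insub i is Some j then e j else set0).
Proof.
case/and3P=> /injectiveP vI /injectiveP eI /forallP ve; split.
- by move=> i j it jt /vI /(congr1 val); rewrite /= !inordK.
- by move=> i j it jt; rewrite !insubT => /eI /(congr1 val).
- move=> i it; rewrite insubT /=.
  have /andP[eH /subsetP sub] := ve (Ordinal it); split=> //; apply: sub.
    by rewrite !inE; apply/orP; left; apply/eqP; congr (v _);
      apply: val_inj; rewrite /= inordK // ltnW.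
  by rewrite !inE; apply/orP; right; apply/eqP; congr (v _);
    apply: val_inj; rewrite /= inordK.
Qed.

Lemma bpath_longest t v e : bpath H t v e -> t <= longest_berge_path H.
Proof.
move=> P; have [vI eI ve] := P.
have tH : t < #|H|.+1.
  rewrite ltnS -[t in t <= _]card_ord.
  rewrite -(card_imset (f := fun i : 'I_t => e i)); last first.
    by move=> i j E; apply: val_inj; apply: eI E; apply: ltn_ord.
  apply/subset_leq_card/subsetP => _ /imsetP[i _ ->].
  by have [] := ve i (ltn_ord i).
apply: (leq_bigmax_cond (F := fun i : 'I__ => nat_of_ord i) (Ordinal tH)) => /=.
apply/existsP; exists [ffun i : 'I_t.+1 => v i].
by apply/existsP; exists [ffun i : 'I_t => e i]; apply: berge_path_of_bpath.
Qed.

Lemma min_vertex_degree_le x : min_vertex_degree H <= vertex_degree H x.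
Proof.
rewrite /min_vertex_degree; have := mem_index_enum x.
elim: (index_enum T) => // y s IHs; rewrite big_cons inE geq_min.
by case/predU1P=> [->|/IHs ->]; rewrite ?leqnn ?orbT.
Qed.

(** Some step of a path from [x] to [y] leaves [C]; otherwise induction along the path keeps it in
    [C] up to [y]. *)
Lemma berge_connected_cut (C : {set T}) x y : berge_connected H ->
  x \in C -> y \notin C ->
  exists h a b, [/\ h \in H, a \in h, a \in C, b \in h & b \notin C].
Proof.
move=> conn xC yC; have [t [v [e [/bpath_of_berge_path P v0 vt]]]] := conn x y.
move: P; set v' := (fun i => v _); set e' := (fun i => _); move=> [_ _ ve].
have v'0 : v' 0 \in C.
  by rewrite /v' (_ : inord 0 = ord0) ?v0 //; apply: val_inj; rewrite /= inordK.
have v't : v' t \notin C.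
  by rewrite /v' (_ : inord t = ord_max) ?vt //; apply: val_inj; rewrite /= inordK.
have [/existsP[i /andP[iC iC']]|/existsPn stay] :=
    boolP [exists i : 'I_t, (v' i \in C) && (v' i.+1 \notin C)].
  by have [? ? ?] := ve i (ltn_ord i); exists (e' i), (v' i), (v' i.+1).
case/negP: v't; elim: {-2}t (leqnn t) => // i IHi it.
have := stay (Ordinal it); rewrite negb_and negbK /=.
by rewrite IHi // ltnW.
Qed.

End Conversion.

Theorem theorem3p5 (k n : nat) (T : finType) (H : {set {set T}})
    (hk : 3 < k) (hn : 4 * k < n) (hT : #|T| = n)
    (hH : is_3graph H) (hconn : berge_connected H)
    (hdeg : 'C(k, 2) < min_vertex_degree H) :
  2 * k + 1 <= longest_berge_path H.
Proof.
pose has_path t := [exists v : {ffun 'I_t.+1 -> T},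
  [exists e : {ffun 'I_t -> {set T}}, berge_path H v e]].
have has_pathP t v e : bpath H t v e -> has_path t.
  move=> P; apply/existsP; exists [ffun i : 'I_t.+1 => v i].
  by apply/existsP; exists [ffun i : 'I_t => e i]; apply: berge_path_of_bpath.
(* Paths grow one edge at a time: for [t <= 2 * k], a path of length [t] with none of length [t.+1]
   contradicts [no_longest]. *)
suff grow t : t <= 2 * k + 1 -> has_path t.
  have /existsP[v /existsP[e /bpath_of_berge_path P]] := grow _ (leqnn _).
  exact: bpath_longest P.
elim: t => [_|t IHt t_le].
  have [x _] : exists x : T, x \in T by apply/card_gt0P; rewrite hT; lia.
  by apply: (has_pathP 0 (fun=> x) (fun=> set0)); split=> // -[|i] // [|j].
have /existsP[v /existsP[e /bpath_of_berge_path P]] := IHt (ltnW t_le).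
have [//|no_path] := boolP (has_path t.+1); exfalso.
apply: (@no_longest T H k t hH hk _ _ _ _ _ _ _ P).
- by move=> x; apply: leq_trans hdeg (min_vertex_degree_le H x).
- by move=> C x y; apply: berge_connected_cut.
- by lia.
- by rewrite hT; lia.
- by move=> v1 e1 /has_pathP P1; case/negP: no_path.
Qed.
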